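(* There exists no fullerene $C_{22}$ with exactly one hexagonal face; that is, there is no convex polyhedron in $\mathbb{R}^3$ all of whose vertices have degree $3$, all of whose faces are pentagons or hexagons, and exactly one of whose faces is a hexagon.
   Context: A fullerene is a convex polyhedron all of whose vertices are incident to exactly three edges and all of whose faces are pentagons or hexagons. The numbers of its pentagonal and hexagonal faces are denoted $p_5$ and $p_6$. By Euler's formula $p_5=12$ and the number of vertices is $20+2p_6$. $C_N$ denotes a fullerene with $N$ vertices, so $C_{22}$ corresponds to $p_6=1$. *)

(* Defs.v *)
From mathcomp Require Import all_boot all_order all_algebra.
From mathcomp Require Import boolp classical_sets functions cardinality reals convex.

Set Implicit Arguments.
Unset Strict Implicit.
Unset Printing Implicit Defensive.

Import Order.TTheory GRing.Theory Num.Theory.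

Local Open Scope classical_set_scope.
Local Open Scope card_scope.
Local Open Scope ring_scope.

Section Polytopes.
Variables (R : realType) (n : nat).
Implicit Types (P F A : set 'rV[R]_n) (v : 'rV[R]_n).

Definition dot (u v : 'rV[R]_n) : R := \sum_(i < n) u ord0 i * v ord0 i.

Definition convex_hull A : set 'rV[R]_n := smallest (@convex_set R 'rV[R]_n) A.

Definition convex_polytope P : Prop :=
  exists2 S : set 'rV[R]_n, finite_set S & P = convex_hull S.

Definition affinely_independent k (x : 'I_k.+1 -> 'rV[R]_n) : Prop :=
  row_free (\matrix_(i < k) (x (lift ord0 i) - x ord0)).

(* No natural number is the dimension of the empty set. *)
Definition affine_dim A (k : nat) : Prop :=
  (exists x : 'I_k.+1 -> 'rV[R]_n,
     (forall i, A (x i)) /\ affinely_independent x) /\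
  (forall x : 'I_k.+2 -> 'rV[R]_n,
     (forall i, A (x i)) -> ~ affinely_independent x).

(* The normal c may be 0, so P itself and set0 count as (improper) faces;
   they play no role once the dimension of the face is prescribed. *)
Definition face P F : Prop :=
  exists (c : 'rV[R]_n) (a : R),
    (forall x, P x -> dot c x <= a) /\ F = P `&` [set x | dot c x = a].

Definition face_of_dim k P : set (set 'rV[R]_n) :=
  [set F | face P F /\ affine_dim F k].

Definition vertices P : set 'rV[R]_n := [set v | face_of_dim 0 P [set v]].

Definition edges P : set (set 'rV[R]_n) := face_of_dim 1 P.

Definition degree_eq P v (m : nat) : Prop :=
  [set E | edges P E /\ E v] #= `I_m.

Definition convex_polygon (m : nat) F : Prop :=
  [/\ convex_polytope F, affine_dim F 2 & vertices F #= `I_m].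

End Polytopes.

Section Fullerenes.
Variable R : realType.
Implicit Types P : set 'rV[R]_3.

Definition convex_polyhedron P : Prop := convex_polytope P /\ affine_dim P 3.

(* In dimension three the two-dimensional faces are simply called faces. *)
Definition facets P : set (set 'rV[R]_3) := face_of_dim 2 P.

Definition pentagonal_faces P : set (set 'rV[R]_3) :=
  facets P `&` [set F | convex_polygon 5 F].

Definition hexagonal_faces P : set (set 'rV[R]_3) :=
  facets P `&` [set F | convex_polygon 6 F].

Definition fullerene P : Prop :=
  [/\ convex_polyhedron P,
      forall v, vertices P v -> degree_eq P v 3 &
      facets P `<=` pentagonal_faces P `|` hexagonal_faces P].

End Fullerenes.

(* Main.v *)
Require Import Defs.
From mathcomp Require Import all_boot all_order all_algebra.
From mathcomp Require Import boolp classical_sets functions cardinality reals convex.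
From mathcomp Require Import unstable interval_inference.
From mathcomp Require Import zify ring lra.

(** Around the unique hexagon everything is forced.  Encode the polyhedron by its
facets alone, through the ternary relation that three distinct facets share a
vertex.  When every vertex has degree three, the facets meeting a given
[m]-gon form a cycle of length [m], consecutive facets of the cycle being
exactly those that meet the [m]-gon at a common vertex ([facet_link]).  Thus
the facets are the vertices of a triangulated closed surface in which every
vertex has degree five, except for one, [H], of degree six.

In such a triangulation ([no_single_hexagon]) let [a_0, ..., a_5] be the link
of [H].  The link of each [a_i] is a pentagon containing the path
[a_(i-1), H, a_(i+1)], and two neighboring ones share a triangle, so a second
ring [b_0, ..., b_5] appears; the same argument applied to the [b_i] shows that
their links are closed up by one common vertex [z] adjacent to all the
[b_i], in this cyclic order.  The [b_i] cannot go around a pentagon in six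
steps, so [z] has degree six and must be [H] itself.  Then the ring of the [b_i]
is the ring of the [a_i] rotated, and both rotations compatible with the
links found so far are refuted.

The geometry goes through affine functions that are nonnegative on a
polytope.  The main tool is [pivot]: tilting a supporting hyperplane about a
face until it hits a new point.  It gives that faces of faces are faces
([face_trans]), that a facet of a facet lies in a second facet ([ridge]), and
that a vertex of a polygon lies on an edge.  Hence every vertex of a polygon
has exactly two neighbors.  No three vertices of a polygon other than a
triangle are pairwise adjacent, because a point on the inner side of
the three lines has nonnegative barycentric coordinates ([simplex_vertex]).  A
two-regular graph without triangles on five or six vertices is a single
cycle ([two_regular_cycle]), which orders the vertices of a facet.  Finally, at
a vertex with three edges each facet misses one edge, and two facets missing
the same edge would share two edges, hence a plane; so at most three facets
meet there ([facets_at_vertex]). *)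

Set Implicit Arguments.
Unset Strict Implicit.
Unset Printing Implicit Defensive.
Import Order.TTheory GRing.Theory Num.Theory.

(** * Vertex links in abstract surfaces *)

Section Links.
Variables (U : eqType) (T : U -> U -> U -> Prop).
Implicit Types (A x y z : U) (c : seq U).

(** In a triangulation whose triangles are the triples related by [T], this is
the link of the vertex [A]: the cycle of the edges opposite to [A]. *)
Definition link_is A c :=
  uniq c /\ forall x y, T A x y <->
    (x \in c /\ y = next c x) \/ (y \in c /\ x = next c y).

Lemma link_rot A c n : link_is A c -> link_is A (rot n c).
Proof.
move=> [uc lc]; split; first by rewrite rot_uniq.
by move=> x y; rewrite lc !mem_rot !next_rot.
Qed.

Lemma link_rev A c : link_is A c -> link_is A (rev c).
Proof.
move=> [uc lc]; split; first by rewrite rev_uniq.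
move=> x y; rewrite lc !mem_rev !next_rev //.
split=> -[[zc ->]|[zc ->]]; [right|left|right|left];
  by rewrite ?mem_next ?mem_prev ?next_prev ?prev_next.
Qed.

Lemma link_neighbor A c x y : link_is A c -> T A x y ->
  [/\ x \in c, y \in c & y = next c x \/ y = prev c x].
Proof.
move=> [uc lc] /lc [[xc ->]|[yc ->]]; rewrite ?mem_next ?mem_prev; split=> //.
  by left.
by right; rewrite prev_next.
Qed.

(** An edge of a triangulated surface lies in two triangles only. *)
Lemma link_third A c x y y' y'' : link_is A c ->
  T A x y -> T A x y' -> T A x y'' -> y' <> y -> y'' <> y -> y' = y''.
Proof.
move=> lc /(link_neighbor lc) [_ _ h] /(link_neighbor lc) [_ _ h'].
move=> /(link_neighbor lc) [_ _ h''] n' n''.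
by case: h h' h'' => ey [] ey' [] ey''; congruence.
Qed.

(** A path of two edges in a five-cycle can be taken as its beginning, up to
rotation and reflection. *)
Lemma link_pentagon A c x0 x1 x2 : link_is A c -> size c = 5 ->
  T A x0 x1 -> T A x1 x2 -> x0 <> x2 ->
  exists x3 x4, link_is A [:: x0; x1; x2; x3; x4].
Proof.
move=> lc sc t01 t12 n02.
(* Reversing the cycle turns a predecessor into a successor. *)
wlog e1 : c lc sc / x1 = next c x0.
  move=> hw; have [_ _ []] := link_neighbor lc t01; first exact: hw lc sc.
  move=> e1; apply: (hw (rev c)); rewrite ?size_rev ?next_rev //.
    exact: link_rev.
  by case: lc.
have [uc lc'] := lc.
have [x0c _ _] := link_neighbor lc t01.
have e2 : x2 = next c x1.
  have [_ _ [//|]] := link_neighbor lc t12.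
  by rewrite e1 prev_next // => e; case: n02.
have [i s es] := rot_to x0c; have := link_rot i lc.
move: e1 e2; rewrite -(next_rot i uc) -(next_rot i uc x1).
have : size (rot i c) = 5 by rewrite size_rot.
rewrite es; case: s es => [//|y1 [|y2 [|y3 [|y4 [|//]]]]] // es _.
rewrite /= eqxx => -> e2 lr.
have [/= /andP[+ _] _] := lr.
rewrite !inE negb_or => /andP[n01 _].
by move: e2; rewrite eq_sym (negPf n01) eqxx => ->; exists y3, y4.
Qed.

Lemma next_nth_mod x0 c i : uniq c -> c != [::] ->
  next c (nth x0 c (i %% size c)) = nth x0 c (i.+1 %% size c).
Proof.
case: c => [//|y p] uc _; rewrite next_nth.
set n := size (y :: p); have i_lt : i %% n < n by rewrite ltn_mod.
rewrite mem_nth // index_uniq //.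
have -> : i.+1 %% n = (i %% n).+1 %% n by rewrite -addn1 -modnDml addn1.
move: i_lt; rewrite ltnS leq_eqVlt => /orP[/eqP ->|lt].
  by rewrite modnn /= nth_default.
by rewrite (modn_small (m := _.+1)) //=; apply: set_nth_default.
Qed.

Lemma link_nth A x0 c i : link_is A c -> c != [::] ->
  T A (nth x0 c (i %% size c)) (nth x0 c (i.+1 %% size c)).
Proof.
move=> [uc lc] c0; apply/lc; left; rewrite mem_nth ?next_nth_mod //.
by rewrite ltn_mod lt0n size_eq0.
Qed.

(** The membership clause is what later refutes an unexpected neighbor. *)
Lemma link5 A x0 x1 x2 x3 x4 : link_is A [:: x0; x1; x2; x3; x4] ->
  (forall x y, T A x y -> x \in [:: x0; x1; x2; x3; x4]) /\
  [/\ T A x0 x1, T A x1 x2, T A x2 x3, T A x3 x4 & T A x4 x0].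
Proof.
move=> lA; split=> [x y /(link_neighbor lA) []//|].
have t i := link_nth x0 i lA isT.
by split; [exact: t 0|exact: t 1|exact: t 2|exact: t 3|exact: t 4].
Qed.

Lemma link5_neq A x0 x1 x2 x3 x4 : link_is A [:: x0; x1; x2; x3; x4] ->
  [/\ x0 <> x1, x0 <> x2, x0 <> x3 & x0 <> x4] /\
  [/\ x1 <> x2, x1 <> x3, x1 <> x4, x2 <> x3 & x2 <> x4] /\ x3 <> x4.
Proof.
move=> [+ _]; rewrite /= !inE !negb_or -!andbA.
move=> /and5P[/eqP n01 /eqP n02 /eqP n03 /eqP n04].
by move=> /and5P[/eqP n12 /eqP n13 /eqP n14 /eqP n23 /and3P[/eqP n24 /eqP n34 _]].
Qed.

End Links.

(** * A single hexagon among pentagons is impossible *)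

Section OneHexagon.
Variables (U : eqType) (T : U -> U -> U -> Prop) (H : U).
Hypothesis Tswap : forall A x y, T A x y -> T x A y.
Hypothesis Trev : forall A x y, T A x y -> T A y x.
Hypothesis Tneq : forall A x y, T A x y -> A <> x.
Variable h : seq U.
Hypotheses (linkH : link_is T H h) (size_h : size h = 6).
Hypothesis pentagon : forall A x y, T A x y -> A <> H ->
  exists2 c, size c = 5 & link_is T A c.

Let a i := nth H h (i %% 6).

Local Lemma aP i : a (i + 6) = a i. Proof. by rewrite /a modnDr. Qed.

Local Lemma a_inj i j : a i = a j -> i = j %[mod 6].
Proof.
have [uh _] := linkH.
by move/eqP; rewrite nth_uniq // ?size_h ?ltn_mod // => /eqP.
Qed.

Local Lemma TH i : T H (a i) (a i.+1).
Proof. by rewrite /a -size_h; apply: link_nth => //; case: (h) size_h. Qed.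

Local Lemma next_a i : next h (a i) = a i.+1.
Proof.
have [uh _] := linkH; rewrite /a -size_h next_nth_mod //.
by case: (h) size_h.
Qed.

Local Lemma prev_a i : prev h (a i) = a (i + 5).
Proof. by rewrite -[a i]aP addnS -next_a prev_next //; case: linkH. Qed.

Local Lemma TH_a i y : T H (a i) y -> y = a i.+1 \/ y = a (i + 5).
Proof. by move/(link_neighbor linkH) => [_ _]; rewrite next_a prev_a. Qed.

Local Lemma TH_ex x y : T H x y -> exists i, x = a i.
Proof.
move/(link_neighbor linkH) => [xh _ _]; exists (index x h).
by rewrite /a modn_small ?nth_index // -size_h index_mem.
Qed.

Local Lemma third A x y y' y'' :
  T A x y -> T A x y' -> T A x y'' -> y' <> y -> y'' <> y -> y' = y''.
Proof.
move=> t; have [eA|nA] := pselect (A = H).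
  by move: t; rewrite eA; apply: link_third linkH.
by have [c _ lc] := pentagon t nA; apply: link_third lc t.
Qed.

Local Lemma path_pentagon A x0 x1 x2 : A <> H ->
  T A x0 x1 -> T A x1 x2 -> x0 <> x2 ->
  exists x3 x4, link_is T A [:: x0; x1; x2; x3; x4].
Proof.
by move=> nA t01 t12; have [c sc lc] := pentagon t01 nA; apply: link_pentagon lc sc t01 t12.
Qed.

Local Lemma a_neqH i : a i <> H.
Proof. by move/esym; apply: Tneq (TH i). Qed.

Local Lemma a_mod i j : i = j %[mod 6] -> a i = a j.
Proof. by rewrite /a => ->. Qed.

(** The triangle on the far side of the edge [a (i+1), a (i+2)] belongs both to the
link of [a (i+1)] and to that of [a (i+2)]; this identifies the last vertex of
one link with the fourth vertex of the previous one.  Indices are read modulo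
six, so [i + 5] stands for [i - 1]. *)
Local Lemma first_ring : exists b : nat -> U, forall i,
  link_is T (a i.+1) [:: a i; H; a i.+2; b i; b (i + 5)].
Proof.
have link i : exists pq, link_is T (a i.+1) [:: a i; H; a i.+2; pq.1; pq.2].
  have [|||p [q lpq]] := @path_pentagon (a i.+1) (a i) H (a i.+2) (@a_neqH _).
  - exact/Trev/Tswap/Trev/TH.
  - exact/Tswap/TH.
  - by move/a_inj; lia.
  - by exists (p, q).
have [f fP] := choice link.
exists (fun i => (f i).1) => i.
suff -> : (f (i + 5)).1 = (f i).2 by [].
have e6 : a (i + 5).+1 = a i by rewrite -addnS aP.
have e7 : a (i + 5).+2 = a i.+1 by apply: a_mod; lia.
have := fP (i + 5); rewrite e6 e7 => l5.
apply: (@third (a i) (a i.+1) H).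
- exact/Trev/Tswap/TH.
- by case: (link5 l5) => _ [].
- by case: (link5 (fP i)) => _ [_ _ _ _ /Trev/Tswap].
- by case: (link5_neq l5) => [[? ? ? ?] [[? ? ? ? ?] ?]]; auto.
- by case: (link5_neq (fP i)) => [[? ? ? ?] [[? ? ? ? ?] ?]]; auto.
Qed.

(** The fifth vertex of the link of [b (i+1)] is the apex of the triangle on the
outer side of the edge [b (i+1), b (i+2)], which the link of [b (i+2)] shares;
so it does not depend on [i]. *)
Local Lemma two_rings : exists (b : nat -> U) (z : U), forall i,
  [/\ b (i + 6) = b i,
      link_is T (a i.+1) [:: a i; H; a i.+2; b i; b (i + 5)] &
      link_is T (b i.+1) [:: b i; a i.+2; a i.+3; b i.+2; z]].
Proof.
have [b lb] := first_ring.
have b6 i : b (i + 6) = b i.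
  have := lb (i + 6); rewrite -!addSn !aP => l6.
  apply: (@third (a i.+1) (a i.+2) H).
  - exact/Trev/Tswap/TH.
  - by case: (link5 l6) => _ [].
  - by case: (link5 (lb i)) => _ [].
  - by case: (link5_neq l6) => [[? ? ? ?] [[? ? ? ? ?] ?]]; auto.
  - by case: (link5_neq (lb i)) => [[? ? ? ?] [[? ? ? ? ?] ?]]; auto.
have link i : exists z, link_is T (b i.+1) [:: b i; a i.+2; a i.+3; b i.+2; z].
  have bi : b (i.+1 + 5) = b i by rewrite addSnnS b6.
  have [_ [_ _ t23 t34 _]] := link5 (lb i.+1); rewrite bi in t34.
  have [_ [_ _ _ t34' _]] := link5 (lb i.+2).
  rewrite addSnnS b6 in t34'.
  have nb : b i.+1 <> H by case: (link5_neq (lb i.+1)) => [[? ? ? ?] [[? ? ? ? ?] ?]]; auto.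
  have [|||r [z lz]] := @path_pentagon (b i.+1) (b i) (a i.+2) (a i.+3) nb.
  - exact/Trev/Tswap.
  - exact/Tswap/Trev.
  - by case: (link5_neq (lb i.+1)); rewrite bi => [[? ? ? ?] [[? ? ? ? ?] ?]]; auto.
  exists z; suff <- : r = b i.+2 by [].
  apply: (@third (b i.+1) (a i.+3) (a i.+2)).
  - exact/Tswap/Trev/Tswap.
  - by case: (link5 lz) => _ [].
  - exact/Tswap/Trev.
  - by case: (link5_neq lz) => [[? ? ? ?] [[? ? ? ? ?] ?]]; auto.
  - by case: (link5_neq (lb i.+2)) => [[? ? ? ?] [[? ? ? ? ?] ?]]; auto.
have [z zP] := choice link.
exists b, (z 0) => i; split=> //.
suff -> : z 0 = z i by [].
elim: i => [//|i ->].
apply: (@third (b i.+1) (b i.+2) (a i.+3)).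
- by case: (link5 (zP i)) => _ [_ _ /Trev].
- by case: (link5 (zP i)) => _ [].
- by case: (link5 (zP i.+1)) => _ [_ _ _ _ /Trev/Tswap].
- by case: (link5_neq (zP i)) => [[? ? ? ?] [[? ? ? ? ?] ?]]; auto.
- by case: (link5_neq (zP i.+1)) => [[? ? ? ?] [[? ? ? ? ?] ?]]; auto.
Qed.

(** If [z] differs from [H], its link is a pentagon around which the [b i] step
one by one, so [b 5 = b 0] although they are adjacent.  Otherwise the [b i]
run through the link of [H]; avoiding the neighbors already known leaves
only the shifts by four and by five, and each of them contradicts the link of
one of the [a i]. *)
Theorem no_single_hexagon : False.
Proof.
have [b [z rings]] := two_rings.
have b6 i : b (i + 6) = b i by case: (rings i).
have la i : link_is T (a i.+1) [:: a i; H; a i.+2; b i; b (i + 5)].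
  by case: (rings i).
have lb i : link_is T (b i.+1) [:: b i; a i.+2; a i.+3; b i.+2; z].
  by case: (rings i).
have Tz i : T z (b i) (b i.+1).
  by have [_ [_ _ _ _ t]] := link5 (lb i); apply/Trev/Tswap.
have nb2 i : b i.+2 <> b i.
  by case: (link5_neq (lb i)) => [[_ _ ? _] _]; auto.
have [zH|nz] := pselect (z = H); last first.
  have [|x3 [x4 lz]] := path_pentagon nz (Tz 0) (Tz 1); first by auto.
  have [[_ _ _ _] [[_ n13 _ _ n24] _]] := link5_neq lz.
  have [_ [_ _ t23 t34 t40]] := link5 lz.
  have e3 : b 3 = x3.
    by apply: third (Trev (Tz 1)) (Tz 2) t23 _ _; auto.
  rewrite -e3 in t34 n13.
  have e4 : b 4 = x4.
    by apply: third (Trev (Tz 2)) (Tz 3) t34 _ _; auto.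
  rewrite -e4 in t40 n24.
  have e5 : b 5 = b 0.
    apply: third (Trev (Tz 3)) (Tz 4) t40 _ _; auto.
    by rewrite e3; case: (link5_neq lz) => -[]; auto.
  have := Tz 5; rewrite (b6 0) e5 => /Tswap/Trev.
  by move/Tneq; apply.
rewrite {z rings lb}zH in Tz.
have na i j : b i = a j -> (j = i + 4 %[mod 6]) \/ (j = i + 5 %[mod 6]).
  move=> e.
  case: (link5_neq (la i)) => [[_ _ n0 _] [[_ _ _ n2 _] _]].
  case: (link5_neq (la i.+1)) => [[_ _ _ n1] [[_ _ _ _ n3] _]].
  rewrite addSnnS b6 in n1 n3.
  have {}n0 k : k < 4 -> j <> i + k %[mod 6].
    move=> k4 /a_mod; rewrite -e.
    case: k k4 => [|[|[|[|//]]]] _; rewrite ?addnS addn0; auto.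
  have := (n0 0 isT, n0 1 isT, n0 2 isT, n0 3 isT).
  by move=> [[[]]]; lia.
have all_a k : b 0 = a k -> k = 4 \/ k = 5 -> forall i, b i = a (i + k).
  move=> e0 k45; elim=> [//|i IH].
  have := Tz i; rewrite IH => /TH_a[] // e.
  by have := na _ _ e; lia.
have [k k45 {all_a}bE] : exists2 k, k = 4 \/ k = 5 & forall i, b i = a (i + k).
  have [j e0] := TH_ex (Tz 0).
  have [e|e] := na _ _ e0; rewrite (a_mod e) in e0.
    by exists 4; [left|apply: all_a; auto].
  by exists 5; [right|apply: all_a; auto].
case: k45 bE => -> bE.
- have [_ [_ _ t _ _]] := link5 (la 3).
  rewrite bE (@a_mod (3 + 4) 1) // in t.
  have [/(_ _ _ (Trev (Tswap (Trev t)))) + _] := link5 (la 0).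
  rewrite !bE !inE => /or4P[|||/orP[]] /eqP //; try by move/a_inj.
  exact: a_neqH.
- have [_ [_ _ t _ _]] := link5 (la 0).
  rewrite bE in t.
  have [/(_ _ _ (Tswap (Trev t))) + _] := link5 (la 4).
  rewrite !bE !inE => /or4P[|||/orP[]] /eqP //; try by move/a_inj.
  exact: a_neqH.
Qed.

End OneHexagon.

(** * Triangle-free two-regular graphs on five or six vertices *)

Local Open Scope classical_set_scope.
Local Open Scope card_scope.
Local Open Scope ring_scope.

Lemma card_seq (T : eqType) (A : set T) m : A #= `I_m ->
  exists r : seq T, [/\ uniq r, size r = m & forall x, A x <-> x \in r].
Proof.
move=> /card_set_bijP [f [fA fI fS]].
have ex (i : 'I_m) : exists x, A x /\ f x = i.
  by have [x Ax fx] := fS i (ltn_ord i); exists x.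
have [g gP] := choice ex.
exists (codom g); split.
- by apply/injectiveP => i j /(congr1 f); rewrite !(gP _).2 => /val_inj.
- by rewrite size_codom card_ord.
move=> x; split=> [Ax|/codomP [i ->]]; last by case: (gP i).
apply/codomP; exists (Ordinal (fA x Ax)).
by apply: fI; rewrite ?inE ?(gP _).2 //; case: (gP (Ordinal (fA x Ax))).
Qed.

Lemma next_all (T : eqType) (x0 : T) (e : T -> T -> Prop) (c : seq T) : uniq c ->
  (forall i, (i < size c)%N -> e (nth x0 c i) (nth x0 c (i.+1 %% size c))) ->
  forall x, x \in c -> e x (next c x).
Proof.
move=> uc ec x xc; have ix : (index x c < size c)%N by rewrite index_mem.
have := ec _ ix; rewrite -next_nth_mod //; last by apply/eqP => c0; rewrite c0 in xc.
by rewrite modn_small // nth_index.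
Qed.

Section TwoRegular.
Variables (T : eqType) (e : T -> T -> Prop) (vs : seq T).
Hypothesis e_in : forall x y, e x y -> [/\ x \in vs, y \in vs & x != y].
Hypothesis e_sym : forall x y, e x y -> e y x.
Hypothesis e_two : forall x, x \in vs ->
  exists y z, y != z /\ forall w, e x w <-> w = y \/ w = z.
Hypothesis no_triangle : forall x y z, e x y -> e y z -> e z x -> False.
Hypothesis vs_uniq : uniq vs.
Hypothesis vs_size : (4 < size vs <= 6)%N.

Lemma other_neighbor x y : e x y -> exists z,
  [/\ z != y, e x z & forall w, e x w -> w = y \/ w = z].
Proof.
move=> exy; have [xv _ _] := e_in exy.
have [y1 [y2 [n12 yP]]] := e_two xv.
have [e1 e2] : e x y1 /\ e x y2 by split; apply/yP; auto.
by case/yP: exy => ->; [exists y2|exists y1]; split=> //;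
  rewrite 1?eq_sym // => w /yP []; auto.
Qed.

Lemma fresh_vertex s : (size s < size vs)%N -> exists2 x, x \in vs & x \notin s.
Proof.
move=> lt; apply/hasP; apply: contraLR lt => /hasPn sub; rewrite -leqNgt.
by apply: uniq_leq_size => // x /sub; rewrite negbK.
Qed.

(** A point outside would bring its two neighbors along, outside as well:
seven points in all. *)
Lemma closed_all s : uniq s -> {subset s <= vs} -> (3 < size s)%N ->
  (forall y w, y \in s -> e y w -> w \in s) -> s =i vs.
Proof.
move=> us sv s4 cl x; apply/idP/idP; first exact: sv.
move=> xv; apply: contraT => xs; have [y [z [yz xP]]] := e_two xv.
have [exy exz] : e x y /\ e x z by split; apply/xP; auto.
have [_ yv xy] := e_in exy; have [_ zv xz] := e_in exz.
have out w : e x w -> w \notin s.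
  by move=> /e_sym exw; apply: contra xs => /cl/(_ exw).
have : (size (s ++ [:: x; y; z]) <= size vs)%N.
  apply: uniq_leq_size.
    rewrite cat_uniq us /= !inE !negb_or xy xz yz xs !out //.
  by move=> w; rewrite mem_cat !inE => /orP[/sv//|/or3P[] /eqP ->].
by rewrite size_cat /=; have /andP[_] := vs_size; lia.
Qed.

(** Walk from a vertex [v0] in both directions, two steps each.  The four points
reached are distinct, because a coincidence would be a triangle or
would close a cycle too early for [closed_all].  The next step either joins
the two ends, or reaches the sixth vertex from both of them. *)
Lemma two_regular_cycle : exists c,
  [/\ uniq c, c =i vs & forall x, x \in c -> e x (next c x)].
Proof.
have [v0 v0v _] := @fresh_vertex [::] (ltn_trans (ltn0Sn _) (andP vs_size).1).
have [v1 [v4 [n14 v0P]]] := e_two v0v.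
have e01 : e v0 v1 by apply/v0P; left.
have e04 : e v0 v4 by apply/v0P; right.
have [v2 [n20 e12 v1P]] := other_neighbor (e_sym e01).
have [v3 [n30 e43 v4P]] := other_neighbor (e_sym e04).
have [_ v1v n01] := e_in e01; have [_ v4v n04] := e_in e04.
have [_ v2v n12] := e_in e12; have [_ v3v n43] := e_in e43.
have n24 : v2 != v4.
  by apply/eqP => e24; rewrite e24 in e12; apply: no_triangle e01 e12 (e_sym e04).
have n31 : v3 != v1.
  by apply/eqP => e31; rewrite e31 in e43; apply: no_triangle e04 e43 (e_sym e01).
have u4 : uniq [:: v0; v1; v2; v4].
  by rewrite /= !inE !negb_or n01 eq_sym n20 n04 n12 n14 n24.
have sub s : all (mem vs) s -> {subset s <= vs} by move/allP.
have big s : s =i vs -> uniq s -> (4 < size s)%N.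
  by move=> sE us; rewrite (perm_size (uniq_perm us vs_uniq sE)); case/andP: vs_size.
have [y [n_y1 e2y v2P]] := other_neighbor (e_sym e12).
have [z [n_z4 e3z v3P]] := other_neighbor (e_sym e43).
have n23 : v2 != v3.
  apply/eqP => e23; rewrite -e23 in e43 v4P.
  suff /big/(_ u4) : [:: v0; v1; v2; v4] =i vs by [].
  apply: closed_all => //; first by apply: sub; rewrite /= v0v v1v v2v v4v.
  have v2P' w : e v2 w -> w = v1 \/ w = v4.
    case/v2P => ->; first by left.
    by case/v2P: (e_sym e43) => e4; [rewrite e4 eqxx in n14|right].
  move=> a w; rewrite !inE => /or4P[] /eqP ->.
  - by case/v0P => ->; rewrite eqxx ?orbT.
  - by case/v1P => ->; rewrite eqxx ?orbT.
  - by case/v2P' => ->; rewrite eqxx ?orbT.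
  - by case/v4P => ->; rewrite eqxx ?orbT.
have u5 : uniq [:: v0; v1; v2; v3; v4].
  rewrite /= !inE !negb_or n01 [v0 == v2]eq_sym n20 [v0 == v3]eq_sym n30 n04.
  by rewrite n12 [v1 == v3]eq_sym n31 n14 n23 n24 [v3 == v4]eq_sym n43.
have s5 : {subset [:: v0; v1; v2; v3; v4] <= vs}.
  by apply: sub; rewrite /= v0v v1v v2v v3v v4v.
have [ey|ny] := eqVneq y v3.
  rewrite {}ey in e2y v2P n_y1; exists [:: v0; v1; v2; v3; v4]; split=> //.
    apply: closed_all => // a w; rewrite !inE.
    have v3P' b : e v3 b -> b = v4 \/ b = v2.
      case/v3P => ->; first by left.
      by case/v3P: (e_sym e2y) => e4; [rewrite e4 eqxx in n24|right].
    case/or4P => [|||/orP[]] /eqP ->.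
    - by case/v0P => ->; rewrite eqxx ?orbT.
    - by case/v1P => ->; rewrite eqxx ?orbT.
    - by case/v2P => ->; rewrite eqxx ?orbT.
    - by case/v3P' => ->; rewrite eqxx ?orbT.
    - by case/v4P => ->; rewrite eqxx ?orbT.
  by apply: (next_all (x0 := v0)) => // -[|[|[|[|[|//]]]]] _ //=; apply: e_sym.
have [_ yv n2y] := e_in e2y; have [_ zv n3z] := e_in e3z.
have n0y : v0 != y.
  apply/eqP => ey; rewrite -ey in e2y; case/v0P: (e_sym e2y) => e2.
    by rewrite e2 eqxx in n12.
  by rewrite e2 eqxx in n24.
have n4y : v4 != y.
  apply/eqP => ey; rewrite -ey in e2y; case/v4P: (e_sym e2y) => e2.
    by rewrite e2 eqxx in n20.
  by rewrite e2 eqxx in n23.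
have n0z : v0 != z.
  apply/eqP => ez; rewrite -ez in e3z; case/v0P: (e_sym e3z) => e3.
    by rewrite e3 eqxx in n31.
  by rewrite e3 eqxx in n43.
have n1z : v1 != z.
  apply/eqP => ez; rewrite -ez in e3z; case/v1P: (e_sym e3z) => e3.
    by rewrite e3 eqxx in n30.
  by rewrite e3 eqxx in n23.
have n2z : v2 != z.
  apply/eqP => ez; rewrite -ez in e3z; case/v2P: (e_sym e3z) => e3.
    by rewrite e3 eqxx in n31.
  by rewrite e3 eqxx in ny.
have u6 : uniq [:: y; v0; v1; v2; v3; v4].
  rewrite cons_uniq u5 andbT !inE !negb_or ny n_y1.
  by rewrite ![y == _]eq_sym n0y n2y n4y.
have s6 : {subset [:: y; v0; v1; v2; v3; v4] <= vs}.
  by move=> a; rewrite inE => /orP[/eqP -> //|]; exact: s5.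
have yz : z = y.
  apply/eqP; apply: contraT => nzy.
  have u7 : uniq [:: z; y; v0; v1; v2; v3; v4].
    rewrite cons_uniq u6 andbT inE negb_or nzy !inE !negb_or n_z4.
    by rewrite ![z == _]eq_sym n0z n1z n2z n3z.
  have : (7 <= size vs)%N.
    apply: (uniq_leq_size u7) => a; rewrite inE => /orP[/eqP -> //|].
    exact: s6.
  by case/andP: vs_size => _ le6 le7; have := leq_trans le7 le6.
rewrite {}yz in e3z {zv n3z n0z n1z n2z n_z4 v3P}.
have p6 : perm_eq [:: v0; v1; v2; y; v3; v4] [:: y; v0; v1; v2; v3; v4].
  exact: permEl (perm_catCA [:: v0; v1; v2] [:: y] [:: v3; v4]).
exists [:: v0; v1; v2; y; v3; v4]; split.
- by rewrite (perm_uniq p6).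
- have [_ E6] := uniq_min_size u6 s6 (andP vs_size).2.
  by move=> a; rewrite (perm_mem p6) E6.
apply: (next_all (x0 := v0)); first by rewrite (perm_uniq p6).
by move=> [|[|[|[|[|[|//]]]]]] _ //=; apply: e_sym.
Qed.
End TwoRegular.

Lemma next_map_uniq (T U : eqType) (g : T -> U) (c : seq T) x : uniq (map g c) ->
  x \in c -> next (map g c) (g x) = g (next c x).
Proof.
move=> ugc xc; have uc := map_uniq ugc.
have c0 : c != [::] by apply/eqP => c0; rewrite c0 in xc.
have gc0 : map g c != [::] by case: (c) c0.
have ix : (index x c < size c)%N by rewrite index_mem.
have := next_nth_mod (g x) (index x c) ugc gc0.
rewrite size_map !(nth_map x) ?ltn_mod ?(leq_ltn_trans _ ix) //.
by rewrite -!(next_nth_mod x _ uc c0) modn_small // nth_index.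
Qed.

Lemma next2_neq (T : eqType) (c : seq T) x : uniq c -> (2 < size c)%N ->
  x \in c -> next c (next c x) != x.
Proof.
move=> uc c2 xc; have ix : (index x c < size c)%N by rewrite index_mem.
have c0 : c != [::] by apply/eqP => c0; rewrite c0 in xc.
have -> : next c x = nth x c ((index x c).+1 %% size c).
  by rewrite -next_nth_mod // modn_small // nth_index.
rewrite next_nth_mod // -[X in _ != X](nth_index x xc) nth_uniq //.
  have [lt|ge] := ltnP (index x c).+2 (size c); first by rewrite modn_small //; lia.
  by rewrite -(subnK ge) modnDr modn_small; lia.
by rewrite ltn_mod (leq_ltn_trans _ ix).
Qed.

Lemma uniq4 (T : eqType) (x y z t : T) : x <> y -> x <> z -> x <> t ->
  y <> z -> y <> t -> z <> t -> uniq [:: x; y; z; t].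
Proof.
move=> /eqP xy /eqP xz /eqP xt /eqP yz /eqP yt /eqP zt.
by rewrite /= !inE !negb_or xy xz xt yz yt zt.
Qed.

(** * Affine functions and affine independence *)

Section AffineGeometry.
Variables (R : realType) (n : nat).
Local Notation V := 'rV[R]_n.
Implicit Types (A B F G P X : set V) (f g phi : V -> R) (s p q v y : V).

(** The sign convention matches the inequality that defines a face. *)
Definition affine phi := exists (c : V) (a : R), forall y, phi y = a - dot c y.

Lemma dotDr (c x y : V) : dot c (x + y) = dot c x + dot c y.
Proof.
by rewrite -big_split; apply: eq_bigr => i _; rewrite mxE mulrDr.
Qed.

Lemma dotZr (c x : V) t : dot c (t *: x) = t * dot c x.
Proof. by rewrite /dot mulr_sumr; apply: eq_bigr => i _; rewrite mxE mulrCA. Qed.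

Lemma dotDl (c d x : V) : dot (c + d) x = dot c x + dot d x.
Proof.
by rewrite -big_split; apply: eq_bigr => i _; rewrite mxE mulrDl.
Qed.

Lemma dotZl (c x : V) t : dot (t *: c) x = t * dot c x.
Proof. by rewrite /dot mulr_sumr; apply: eq_bigr => i _; rewrite mxE mulrA. Qed.

Lemma dot_sumr I (r : seq I) (c : V) (w : I -> R) (x : I -> V) :
  dot c (\sum_(i <- r) w i *: x i) = \sum_(i <- r) w i * dot c (x i).
Proof.
elim: r => [|i r IH]; last by rewrite !big_cons dotDr dotZr IH.
by rewrite !big_nil /dot big1 // => i _; rewrite mxE mulr0.
Qed.

Lemma affineDZ f g t : affine f -> affine g -> affine (fun y => g y + t * f y).
Proof.
move=> [c [a fE]] [d [b gE]]; exists (d + t *: c), (b + t * a) => y.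
by rewrite fE gE dotDl dotZl; ring.
Qed.

Lemma affine_cst a : affine (fun=> a).
Proof.
exists 0, a => y; rewrite /dot big1 ?subr0 // => i _; by rewrite mxE mul0r.
Qed.

Lemma affineN f : affine f -> affine (fun y => - f y).
Proof.
move=> /(affineDZ (-1))/(_ (affine_cst 0)) [c [a E]].
by exists c, a => y; rewrite -E; ring.
Qed.

Lemma affine_subc f a : affine f -> affine (fun y => f y - a).
Proof.
move=> af; have [c [b E]] := affineDZ (- a) (affine_cst 1) af.
by exists c, b => y; rewrite -E mulr1.
Qed.

Lemma affine_sum f k (w : 'I_k -> R) (x : 'I_k -> V) : affine f ->
  f (\sum_i w i *: x i) = \sum_i w i * f (x i) + (1 - \sum_i w i) * f 0.
Proof.
move=> [c [a fE]]; rewrite fE dot_sumr.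
under [in RHS]eq_bigr do rewrite fE mulrBr.
rewrite sumrB -mulr_suml fE.
have -> : dot c 0 = 0 by rewrite -[0 in LHS](scale0r c) dotZr mul0r.
by rewrite subr0; ring.
Qed.

Lemma affine_comb f k (w : 'I_k -> R) (x : 'I_k -> V) : affine f ->
  \sum_i w i = 1 -> f (\sum_i w i *: x i) = \sum_i w i * f (x i).
Proof. by move=> af w1; rewrite affine_sum // w1 subrr mul0r addr0. Qed.

Lemma affine_comb0 f k (w : 'I_k -> R) (x : 'I_k -> V) : affine f ->
  \sum_i w i = 0 -> \sum_i w i *: x i = 0 -> \sum_i w i * f (x i) = 0.
Proof.
move=> af w0 x0; have := affine_sum w x af; rewrite x0 w0 subr0 mul1r.
by move/eqP; rewrite -subr_eq subrr eq_sym => /eqP.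
Qed.

(** The symmetric form of affine independence, in which no point is singled
out as the origin. *)
Lemma indepP k (x : 'I_k.+1 -> V) : affinely_independent x <->
  forall w : 'I_k.+1 -> R,
    \sum_i w i = 0 -> \sum_i w i *: x i = 0 -> forall i, w i = 0.
Proof.
rewrite /affinely_independent; set M := (\matrix_i _).
have mulM (u : 'rV_k) : u *m M =
    \sum_i u ord0 i *: x (lift ord0 i) - (\sum_i u ord0 i) *: x ord0.
  rewrite mulmx_sum_row scaler_suml -sumrB; apply: eq_bigr => i _.
  by rewrite rowK scalerBr.
split=> [fM w w0 x0|wP].
  pose u := \row_i w (lift ord0 i).
  have uE i : u ord0 i = w (lift ord0 i) by rewrite mxE.
  have sE : w ord0 = - \sum_i w (lift ord0 i).
    by apply/eqP; rewrite -addr_eq0 -(big_ord_recl _ w) w0.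
  have u0 : u = 0.
    apply/eqP; rewrite -(mulmx_free_eq0 _ fM) mulM.
    move: x0; rewrite big_ord_recl /= sE scaleNr addrC => {2}<-.
    by apply/eqP; congr (_ - _ *: _); apply: eq_bigr => i _; rewrite uE.
  have wS i : w (lift ord0 i) = 0 by rewrite -uE u0 mxE.
  move=> i; case: (unliftP ord0 i) => [j ->|->] //.
  by rewrite sE big1 ?oppr0.
apply: inj_row_free => u uM0.
pose w i := if unlift ord0 i is Some j then u ord0 j else - \sum_i u ord0 i.
have wS i : w (lift ord0 i) = u ord0 i by rewrite /w liftK.
have w0 : w ord0 = - \sum_i u ord0 i by rewrite /w unlift_none.
apply/rowP => j; rewrite mxE -wS; apply: wP.
  by rewrite big_ord_recl /= w0 (eq_bigr _ (fun i _ => wS i)) addNr.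
rewrite big_ord_recl w0 (eq_bigr (fun i => u ord0 i *: x (lift ord0 i))).
  by rewrite scaleNr addrC -mulM.
by move=> i _; rewrite wS.
Qed.

(** The right inverse of the matrix of differences provides the coefficients. *)
Lemma indep_interp k (x : 'I_k.+1 -> V) (a : 'I_k.+1 -> R) :
  affinely_independent x -> exists2 phi, affine phi & forall i, phi (x i) = a i.
Proof.
move=> /row_freeP[B]; set M := (\matrix_i _) => MB.
pose c := (B *m \col_i (a (lift ord0 i) - a ord0))^T.
have dotE y : dot c y = (y *m c^T) ord0 ord0.
  by rewrite mxE; apply: eq_bigr => i _; rewrite [RHS]mulrC; congr (_ * _); rewrite [RHS]mxE.
have cM i : dot c (x (lift ord0 i) - x ord0) = a (lift ord0 i) - a ord0.
  rewrite dotE trmxK -[_ - _ in LHS](rowK (fun i => x (lift ord0 i) - x ord0)).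
  by rewrite -row_mul mulmxA MB mul1mx !mxE.
exists (fun y => a ord0 - dot c (x ord0) - dot (-1 *: c) y).
  by exists (-1 *: c), (a ord0 - dot c (x ord0)).
move=> i; rewrite dotZl.
case: (unliftP ord0 i) => [j ->|->]; last by ring.
have := cM j; rewrite dotDr -[- x ord0]scaleN1r dotZr => h.
by lra.
Qed.

Definition cons_pt k s (x : 'I_k -> V) (i : 'I_k.+1) : V :=
  if unlift ord0 i is Some j then x j else s.

Lemma cons_pt0 k s (x : 'I_k -> V) : cons_pt s x ord0 = s.
Proof. by rewrite /cons_pt unlift_none. Qed.

Lemma cons_ptS k s (x : 'I_k -> V) i : cons_pt s x (lift ord0 i) = x i.
Proof. by rewrite /cons_pt liftK. Qed.

Lemma cons_pt_in k s (x : 'I_k -> V) A :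
  A s -> (forall i, A (x i)) -> forall i, A (cons_pt s x i).
Proof. by move=> As Ax i; rewrite /cons_pt; case: unlift. Qed.

Lemma sum_cons_pt k s (x : 'I_k -> V) (w : 'I_k.+1 -> R) :
  \sum_i w i *: cons_pt s x i =
  w ord0 *: s + \sum_i w (lift ord0 i) *: x i.
Proof.
rewrite big_ord_recl cons_pt0; congr (_ + _).
by apply: eq_bigr => i _; rewrite cons_ptS.
Qed.

Lemma indep_const s : affinely_independent (fun _ : 'I_1 => s).
Proof. by apply/indepP => w; rewrite big_ord1 => w0 _ i; rewrite ord1. Qed.

Lemma cons_pt_indep k (x : 'I_k.+1 -> V) s phi : affine phi ->
  affinely_independent x -> (forall i, phi (x i) = 0) -> phi s != 0 ->
  affinely_independent (cons_pt s x).
Proof.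
move=> aphi /indepP ix phix phis; apply/indepP => w w0 x0.
have ws : w ord0 = 0.
  have := affine_comb0 aphi w0 x0; rewrite big_ord_recl cons_pt0 big1 => [|i _].
    by move/eqP; rewrite addr0 mulf_eq0 (negPf phis) orbF => /eqP.
  by rewrite cons_ptS phix mulr0.
move: w0 x0; rewrite sum_cons_pt big_ord_recl ws scale0r !add0r => w0 x0 i.
by case: (unliftP ord0 i) => [j ->|->] //; apply: (ix (w \o lift ord0)).
Qed.

Lemma cons_pt_span k (x : 'I_k.+1 -> V) s :
  affinely_independent x -> ~ affinely_independent (cons_pt s x) ->
  exists2 w : 'I_k.+1 -> R, \sum_i w i = 1 & s = \sum_i w i *: x i.
Proof.
move=> /indepP ix nix; apply: contrapT => nw; apply: nix.
apply/indepP => w; rewrite sum_cons_pt => w0 x0.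
have [ws|ws] := eqVneq (w ord0) 0.
  move: w0 x0; rewrite big_ord_recl ws scale0r !add0r => w0 x0 i.
  by case: (unliftP ord0 i) => [j ->|->] //; apply: (ix (w \o lift ord0)).
case: nw; exists (fun i => - (w (lift ord0 i) / w ord0)).
  rewrite sumrN -mulr_suml; move: w0; rewrite big_ord_recl => /eqP.
  by rewrite addrC addr_eq0 => /eqP ->; field.
move/eqP: x0; rewrite addr_eq0 => /eqP x0.
apply: (scalerI ws); rewrite x0 scaler_sumr -sumrN; apply: eq_bigr => i _.
by rewrite scalerA -scaleNr; congr (_ *: _); field.
Qed.

Lemma dim_span A k (x : 'I_k.+1 -> V) s : affine_dim A k ->
  (forall i, A (x i)) -> affinely_independent x -> A s ->
  exists2 w : 'I_k.+1 -> R, \sum_i w i = 1 & s = \sum_i w i *: x i.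
Proof.
move=> [_ dA] Ax ix As; apply: cons_pt_span => //.
exact: dA (cons_pt_in As Ax).
Qed.

Lemma dim_vanish A k (x : 'I_k.+1 -> V) phi : affine_dim A k ->
  (forall i, A (x i)) -> affinely_independent x -> affine phi ->
  (forall i, phi (x i) = 0) -> forall s, A s -> phi s = 0.
Proof.
move=> dA Ax ix aphi phix s As; have [w w1 ->] := dim_span dA Ax ix As.
by rewrite affine_comb // big1 // => i _; rewrite phix mulr0.
Qed.

(** Otherwise the [l + 1] independent points of [A] would be affine
combinations of [k + 1] points with [k < l], and the matrix of coefficients
would have a kernel. *)
Lemma dim_extend A k l (x : 'I_k.+1 -> V) : affine_dim A l -> (k < l)%N ->
  (forall i, A (x i)) -> affinely_independent x ->
  exists2 s, A s & affinely_independent (cons_pt s x).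
Proof.
move=> [[y [Ay /indepP iy]] _] kl Ax ix; apply: contrapT => next.
have spanx j : exists w : 'I_k.+1 -> R,
    \sum_i w i = 1 /\ y j = \sum_i w i *: x i.
  have [|w w1 wE] := @cons_pt_span _ x (y j) ix; last by exists w.
  by move=> iyj; apply: next; exists (y j).
have [W WP] := choice spanx; pose M := \matrix_(j, i) W j i.
suff : row_free M.
  rewrite /row_free eqn_leq => /andP[_ /leq_trans/(_ (rank_leq_col M))].
  by rewrite ltnS leqNgt kl.
apply: inj_row_free => u uM.
have uW i : \sum_j u ord0 j * W j i = 0.
  have /rowP/(_ i) := uM; rewrite [LHS]mxE [RHS]mxE => uM0.
  by rewrite -[RHS]uM0; apply: eq_bigr => j _; rewrite mxE.
apply/rowP => j; rewrite mxE; apply: iy => [|].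
  rewrite (eq_bigr (fun m => \sum_i u ord0 m * W m i)) => [|m _].
    by rewrite exchange_big big1 // => i _; apply: uW.
  by rewrite -mulr_sumr (WP m).1 mulr1.
under eq_bigr => i _ do rewrite (WP i).2 scaler_sumr.
rewrite exchange_big big1 // => i _.
under eq_bigr => m _ do rewrite scalerA.
by rewrite -scaler_suml uW scale0r.
Qed.

(** Independent points in the hyperplane bound the dimension from below; they
bound it from above since too many of them would force [phi] to vanish on [A]. *)
Lemma cut_dim A k (x : 'I_k.+1 -> V) s phi : affine_dim A k.+1 ->
  affine phi -> A s -> phi s != 0 ->
  (forall i, A (x i) /\ phi (x i) = 0) -> affinely_independent x ->
  affine_dim (A `&` [set y | phi y = 0]) k.
Proof.
move=> dA aphi As phis Ax ix; split; first by exists x.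
move=> y By iy; move/eqP: phis; apply.
by apply: (dim_vanish dA _ iy) => // i; case: (By i).
Qed.

Lemma dim0_eq A s : affine_dim A 0 -> A s -> A = [set s].
Proof.
move=> dA As; apply/seteqP; split=> y /= => [Ay|->//].
have [w] := dim_span dA (fun=> As) (indep_const s) Ay.
by rewrite !big_ord1 => -> ->; rewrite scale1r.
Qed.

Lemma dim_set1 s : affine_dim [set s] 0.
Proof.
split; first by exists (fun=> s); split=> //; apply: indep_const.
move=> x xs /indepP ix.
have xE i : x i = s by have := xs i.
pose w (i : 'I_2) : R := if i == ord0 then 1 else -1.
suff : w ord0 = 0 by rewrite /w eqxx => /eqP; rewrite oner_eq0.
apply: ix; rewrite !big_ord_recl big_ord0 /w //= ?xE; first by ring.
by rewrite scale1r scaleN1r addr0 subrr.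
Qed.

End AffineGeometry.

(** * Faces of a polytope *)

Section Faces.
Variables (R : realType) (n : nat).
Local Notation V := 'rV[R]_n.
Implicit Types (A B E F G P X S : set V) (f g phi : V -> R) (s p q v y : V).

Lemma hull_ge0 S f : affine f -> (forall s, S s -> 0 <= f s) ->
  forall y, convex_hull S y -> 0 <= f y.
Proof.
move=> [c [a fE]] fS; apply: smallest_sub fS => y z t; rewrite !inE !fE => fy fz.
rewrite dotDr !dotZr /onem.
have t0 : 0 <= t%:num by [].
have t1 : t%:num <= 1 by [].
have : 0 <= t%:num * (a - dot c y) + (1 - t%:num) * (a - dot c z).
  by rewrite addr_ge0 // mulr_ge0 // subr_ge0.
by congr (_ <= _); ring.
Qed.

Lemma seq_argmin (r : seq V) (D : pred V) f : has D r ->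
  exists s, [/\ s \in r, D s & forall y, y \in r -> D y -> f s <= f y].
Proof.
elim: r => [//|z r IH] /=; have [/IH [s [sr Ds smin]] _|nr] := boolP (has D r).
  have [Dz|nDz] := boolP (D z); last first.
    exists s; split; rewrite ?inE ?sr ?orbT // => y; rewrite inE.
    by case/orP => [/eqP -> Dz|]; [rewrite Dz in nDz|exact: smin].
  have [le|lt] := leP (f s) (f z).
    exists s; split; rewrite ?inE ?sr ?orbT // => y; rewrite inE.
    by case/orP => [/eqP ->|] //; exact: smin.
  exists z; split; rewrite ?inE ?eqxx // => y; rewrite inE.
  case/orP => [/eqP -> //|yr Dy].
  exact: le_trans (ltW lt) (smin _ yr Dy).
rewrite orbF => Dz; exists z; split; rewrite ?inE ?eqxx // => y; rewrite inE.
case/orP => [/eqP -> //|yr Dy]; case/hasP: nr; by exists y.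
Qed.

(** Increase the slope of [g + t * f] until it becomes nonnegative: the smallest
value of [g s / f s] over the generators off the hyperplane gives the critical
[t], and the generator attaining it is the new contact point. *)
Lemma hull_pivot S f g : finite_set S -> affine f -> affine g ->
  (forall s, S s -> 0 <= f s) -> (forall s, S s -> f s = 0 -> 0 <= g s) ->
  (exists2 y, convex_hull S y & f y != 0) ->
  exists t s, [/\ S s, 0 < f s, g s + t * f s = 0 &
    forall y, convex_hull S y -> 0 <= g y + t * f y].
Proof.
move=> /finite_seqP [r ->] af ag f0 g0 [y Xy fy].
have [|s [sr fs smin]] := @seq_argmin r (fun s => f s != 0) (fun s => g s / f s).
  apply: contraT => /hasPn fr0; move/eqP: fy; case; apply/le_anti/andP; split.
    rewrite -oppr_ge0; apply: hull_ge0 (affineN af) _ _ Xy => s /fr0.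
    by rewrite negbK => /eqP ->; rewrite oppr0.
  exact: hull_ge0 af f0 _ Xy.
have fpos z : z \in r -> f z != 0 -> 0 < f z.
  by move=> zr fz; rewrite lt_neqAle eq_sym fz f0.
exists (- (g s / f s)), s; split=> //; first exact: fpos.
  by field.
apply: hull_ge0 (affineDZ _ af ag) _ => z zr.
have [fz|fz] := eqVneq (f z) 0; first by rewrite fz mulr0 addr0 g0.
rewrite mulNr subr_ge0 -ler_pdivlMr ?fpos //; exact: smin.
Qed.

Lemma faceP P F : face P F <-> exists phi,
  [/\ affine phi, forall y, P y -> 0 <= phi y & F = P `&` [set y | phi y = 0]].
Proof.
split=> [[c [a [cP ->]]]|[phi [[c [a phiE]] phiP ->]]].
  exists (fun y => a - dot c y); split; first by exists c, a.
    by move=> y /cP; rewrite subr_ge0.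
  apply/seteqP; split=> y /= [Py]; first by move=> ->; rewrite subrr.
  by move/eqP; rewrite subr_eq0 => /eqP <-.
exists c, a; split; first by move=> y /phiP; rewrite phiE subr_ge0.
apply/seteqP; split=> y /= [Py]; rewrite phiE.
  by move/eqP; rewrite subr_eq0 => /eqP <-.
by move=> ->; rewrite subrr.
Qed.

Lemma face_sub P F : face P F -> F `<=` P.
Proof. by move=> /faceP [phi [_ _ ->]] y []. Qed.

Lemma face_restrict P F G : face P G -> G `<=` F -> F `<=` P -> face F G.
Proof.
move=> /faceP [phi [aphi phiP ->]] GF FP; apply/faceP; exists phi; split=> //.
  by move=> y /FP/phiP.
apply/seteqP; split=> y /= [yP phi0]; split=> //; last exact: FP.
exact: GF.
Qed.

(** Gift wrapping: the supporting hyperplane [f = 0] is rotated about its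
intersection with [g = 0] until it meets a point [s] outside the old face. *)
Lemma pivot X f g : convex_polytope X -> affine f -> affine g ->
  (forall y, X y -> 0 <= f y) -> (forall y, X y -> f y = 0 -> 0 <= g y) ->
  (exists2 y, X y & f y != 0) ->
  exists t s, [/\ X s, 0 < f s, g s + t * f s = 0 &
    forall y, X y -> 0 <= g y + t * f y].
Proof.
move=> [S fS ->] af ag f0 g0 fX.
have SX : S `<=` convex_hull S by exact: sub_gen_smallest.
have [s /SX/f0|s /SX/g0|t [s [/SX]]] // := hull_pivot fS af ag _ _ fX.
by exists t, s.
Qed.

(** A face needs no generators of its own: a generator lying on it that minimizes
[k] among those is a minimizer on the whole face, by tilting [f]. *)
Lemma polytope_argmin X f k : convex_polytope X -> affine f -> affine k ->
  (forall y, X y -> 0 <= f y) -> (exists2 y, X y & f y = 0) ->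
  exists s, [/\ X s, f s = 0 & forall y, X y -> f y = 0 -> k s <= k y].
Proof.
move=> [S fS ->] af ak f0 [z Xz fz].
have SX : S `<=` convex_hull S by exact: sub_gen_smallest.
have [r Sr] : exists r : seq V, S = [set` r] by exact/finite_seqP.
have [|s [sr /eqP fs smin]] := @seq_argmin r (fun s => f s == 0) k.
  apply: contraT => /hasPn fr0.
  have [e e0 er] : exists2 e : R, 0 < e & forall s, S s -> e <= f s.
    have [hr|nr] := boolP (has predT r).
      have [s [sr _ smin]] := seq_argmin f hr.
      exists (f s); last by rewrite Sr => y yr; apply: smin.
      by rewrite lt_neqAle eq_sym fr0 // f0 //; apply: SX; rewrite Sr.
    exists 1 => // s; rewrite Sr => sr.
    by case/hasP: nr; exists s.
  have := @hull_ge0 S (fun y => f y - e) (affine_subc e af) _ z Xz.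
  rewrite fz sub0r oppr_ge0 leNgt e0; apply=> s /er.
  by rewrite subr_ge0.
have kS y : S y -> f y = 0 -> 0 <= k y - k s.
  by rewrite Sr => yr fy; rewrite subr_ge0; apply: smin => //; apply/eqP.
exists s; split=> // [|y Xy fy]; first by apply: SX; rewrite Sr.
rewrite -subr_ge0; clear z Xz fz.
have [ex|nex] := pselect (exists2 y, convex_hull S y & f y != 0).
  have [t [_ [_ _ _ /(_ _ Xy)]]] :=
    hull_pivot fS af (affine_subc (k s) ak) (fun s Ss => f0 s (SX s Ss)) kS ex.
  by rewrite fy mulr0 addr0.
apply: (hull_ge0 (affine_subc (k s) ak)) Xy => x Sx; apply: kS => //.
by apply: contrapT => /eqP fx; apply: nex; exists x => //; apply: SX.
Qed.

(** Past the critical slope of [pivot], the tilted function vanishes on [G] only. *)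
Lemma face_trans X F G : convex_polytope X -> face X F -> face F G -> face X G.
Proof.
move=> pX /faceP [f [af f0 FE]] /faceP [g [ag g0 GE]].
have [ex|nex] := pselect (exists2 y, X y & f y != 0); last first.
  have <- : F = X; last by apply/faceP; exists g.
  rewrite FE; apply/seteqP; split=> [y []//|y Xy]; split=> //=.
  by apply: contrapT => /eqP fy; apply: nex; exists y.
have [|t [_ [_ _ _ h0]]] := pivot pX af ag f0 _ ex.
  by move=> y Xy fy; apply: g0; rewrite FE.
(* At the slope [t] the function may vanish outside [G]; at [t + 1] it does not. *)
apply/faceP; exists (fun y => g y + (t + 1) * f y); split.
- exact: affineDZ.
- by move=> y Xy; rewrite mulrDl mul1r addrA addr_ge0 ?h0 ?f0.
rewrite GE FE; apply/seteqP; split=> y /=.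
  by move=> [[Xy ->] ->]; split=> //; ring.
move=> [Xy]; rewrite mulrDl mul1r addrA => e.
have := h0 y Xy; have := f0 y Xy => fy hy.
have fy0 : f y = 0 by lra.
by move: e; rewrite fy0 mulr0 !addr0 => ->.
Qed.

(** A hyperplane containing all of [P] would make the facet equal to [P], whose
dimension is larger. *)
Lemma facet_functional P F k : affine_dim P k.+1 -> face_of_dim k P F ->
  exists phi, [/\ affine phi, forall y, P y -> 0 <= phi y,
    F = P `&` [set y | phi y = 0] & exists2 s, P s & 0 < phi s].
Proof.
move=> [[x [Px ix]] _] [/faceP [phi [aphi phi0 FE]] [_ dF]].
exists phi; split=> //; apply: contrapT => nex; apply: (dF x) ix => i.
rewrite FE; split=> //=; apply/eqP; apply: contraT => phix.
by case: nex; exists (x i); rewrite // lt_neqAle eq_sym phix phi0.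
Qed.

(** A face of dimension [k] is cut out of the polytope by its affine span. *)
Lemma face_eq P k E E' (x : 'I_k.+1 -> V) :
  face_of_dim k P E -> face_of_dim k P E' -> affinely_independent x ->
  (forall i, E (x i)) -> (forall i, E' (x i)) -> E = E'.
Proof.
move=> fE fE' ix.
wlog suff sub : E E' fE fE' / (forall i, E (x i)) -> (forall i, E' (x i)) -> E `<=` E'.
  by move=> Ex E'x; apply/seteqP; split; apply: sub.
move=> Ex E'x; have [/faceP [phi [aphi _ E'E]] _] := fE'.
have [/face_sub EP dE] := fE.
move=> y Ey; rewrite E'E; split; first exact: EP.
apply: (dim_vanish dE Ex ix aphi) Ey => i.
by have := E'x i; rewrite E'E => -[].
Qed.

(** Rotating the hyperplane of [F] about [E] stops at another facet. *)
Lemma ridge X F E k : convex_polytope X -> affine_dim X k.+2 ->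
  face_of_dim k.+1 X F -> face_of_dim k F E ->
  exists G, [/\ face_of_dim k.+1 X G, G <> F & E `<=` G].
Proof.
move=> pX dX fF fE; have [_ dF] := fF.
have [f [af f0 FE [s0 Xs0 fs0]]] := facet_functional dX fF.
have [g [ag g0 EE [q Fq gq]]] := facet_functional dF fE.
have [|t [s [Xs fs hs h0]]] := pivot pX af ag f0 _ (ex_intro2 _ _ s0 Xs0 (lt0r_neq0 fs0)).
  by move=> y Xy fy; apply: g0; rewrite FE.
have [Xq fq] : X q /\ f q = 0 by move: Fq; rewrite FE => -[].
have EG : E `<=` X `&` [set y | g y + t * f y = 0].
  move=> y; rewrite EE FE => -[[Xy fy] gy]; split=> //=.
  by rewrite [g y]gy [f y]fy mulr0 addr0.
exists (X `&` [set y | g y + t * f y = 0]); split=> //; last first.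
  move=> GF; suff : F s by rewrite FE => -[_ fs'_]; rewrite [f s]fs'_ ltxx in fs.
  by rewrite -GF.
have ah : affine (fun y => g y + t * f y) by exact: affineDZ.
split; first by apply/faceP; exists (fun y => g y + t * f y).
have [_ [[x [Ex ix]] _]] := fE.
have Fx i : F (x i) by move: (Ex i); rewrite EE => -[].
apply: (@cut_dim _ _ X _ (cons_pt s x) q) => //.
- by rewrite fq mulr0 addr0 lt0r_neq0.
- move=> i; rewrite /cons_pt; case: unlift => [j|//].
  exact: EG.
- apply: (cons_pt_indep af ix) => [i|]; last exact: lt0r_neq0.
  by move: (Fx i); rewrite FE => -[].
Qed.

(** The functions of the hypothesis measure the barycentric coordinates of a
point of [A] up to a positive factor, so all coordinates are nonnegative; an
exposed point then has all its weight on a single [x i].  Used for segments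
and triangles. *)
Lemma simplex_vertex A k (x : 'I_k.+1 -> V) y : affine_dim A k ->
  (forall i, A (x i)) -> affinely_independent x ->
  (forall i, exists phi, [/\ affine phi, forall z, A z -> 0 <= phi z,
     forall j, j != i -> phi (x j) = 0 & phi (x i) != 0]) ->
  vertices A y -> exists i, y = x i.
Proof.
move=> dA Ax ix facets [/faceP [psi [apsi psi0 yE]] _].
have [Ay psiy] : A y /\ psi y = 0.
  by have : [set y] y by []; rewrite [X in X y -> _]yE => -[].
have [w w1 yw] := dim_span dA Ax ix Ay.
have w0 i : 0 <= w i.
  have [phi [aphi phi0 phij phii]] := facets i.
  have phii0 : 0 < phi (x i) by rewrite lt_neqAle eq_sym phii phi0.
  have := phi0 y Ay; rewrite yw affine_comb // (bigD1 i) //= big1 => [|j ji].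
    by rewrite addr0 pmulr_lge0.
  by rewrite phij // mulr0.
have : \sum_i w i * psi (x i) = 0 by rewrite -affine_comb // -yw.
move/eqP; rewrite psumr_eq0 => [|i _]; last by rewrite mulr_ge0 ?psi0.
move=> /allP wpsi.
have [i wi] : exists i, w i != 0.
  apply: contrapT => nw; move: w1; rewrite big1 => [/eqP|i _].
    by rewrite eq_sym oner_eq0.
  by apply/eqP; apply: contraT => wi; case: nw; exists i.
exists i; have /= := wpsi i (mem_index_enum i).
rewrite mulf_eq0 (negPf wi) => /eqP psii.
have : [set y] (x i) by rewrite yE.
by [].
Qed.

Lemma pair_indep p q : p <> q -> affinely_independent (cons_pt p (fun _ : 'I_1 => q)).
Proof.
move=> pq; apply/indepP => w; rewrite sum_cons_pt big_ord_recl !big_ord1 => w0.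
have -> : w ord0 = - w (lift ord0 ord0) by apply/eqP; rewrite -addr_eq0 w0.
rewrite scaleNr addrC -scalerBr => /eqP; rewrite scaler_eq0 subr_eq0.
case/orP => [/eqP wq|/eqP //]; last by move=> qp; case: pq.
move=> i; case: (unliftP ord0 i) => [j ->|->]; first by rewrite ord1.
by move/eqP: w0; rewrite wq addr0 => /eqP.
Qed.

End Faces.

(** * Edges and vertices of a polygon *)

Section Polygons.
Variables (R : realType) (n : nat).
Local Notation V := 'rV[R]_n.
Implicit Types (A B E F G P X S : set V) (f g phi : V -> R) (s p q u v w y : V).

Lemma vertex_functional P v : vertices P v -> exists phi,
  [/\ affine phi, forall y, P y -> 0 <= phi y, phi v = 0 &
      forall y, P y -> phi y = 0 -> y = v].
Proof.
move=> [/faceP [phi [aphi phi0 vE]] _]; exists phi; split=> //.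
  have : [set v] v by []; rewrite [X in X v -> _]vE.
  by case.
move=> y Py phiy; have : (P `&` [set z | phi z = 0]) y by [].
by rewrite -vE.
Qed.

Lemma vertex_in P v : vertices P v -> P v.
Proof. by move=> [/face_sub vP _]; apply: vP. Qed.

Lemma face_of_dim_face P F G k : convex_polytope P -> face P F ->
  face_of_dim k F G <-> face_of_dim k P G /\ G `<=` F.
Proof.
move=> pP fF; split=> [[fG dG]|[[fG dG] GF]].
  split; last exact: face_sub fG.
  by split=> //; apply: face_trans fF fG.
split=> //; apply: face_restrict fG GF _; exact: face_sub fF.
Qed.

Lemma vertices_face P F v : convex_polytope P -> face P F ->
  vertices F v <-> vertices P v /\ F v.
Proof.
move=> pP fF; rewrite /vertices /= (face_of_dim_face _ _ pP fF).
split=> -[vP vF]; split=> //; first exact: vF.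
by move=> y ->.
Qed.

Lemma edge_point F E v : edges F E -> E v ->
  exists2 p, E p & affinely_independent (cons_pt p (fun _ : 'I_1 => v)).
Proof.
by move=> [_ dE] Ev; apply: (dim_extend dE) => //; apply: indep_const.
Qed.

(** The endpoints of an edge are the minimum and the maximum of a function that
is not constant on it; a third vertex is excluded by [simplex_vertex]. *)
Lemma edge_vertices F E v : convex_polytope F -> edges F E -> vertices F v ->
  E v -> exists u, [/\ u <> v, vertices F u, E u &
    forall w, vertices F w -> E w -> w = v \/ w = u].
Proof.
move=> pF eE vv Ev; have [fE dE] := eE.
have [[x [Ex ix]] _] := dE.
have [k ak kE] := indep_interp (fun i => if i == ord0 then 0 else 1) ix.
have k0 := kE ord0; have k1 := kE ord_max; rewrite /= in k0 k1.
have [f [af f0 EE]] := (faceP F E).1 fE.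
have end_of l : affine l -> (exists i j, l (x i) != l (x j)) ->
    exists s, [/\ vertices F s, E s & forall i, l s <= l (x i)].
  move=> al [i [j lij]].
  have [|s [Fs fs smin]] := polytope_argmin pF af al f0.
    by exists v; move: Ev; rewrite EE => -[].
  have Es : E s by rewrite EE.
  have Emin y : E y -> l s <= l y by rewrite EE => -[Fy fy]; apply: smin.
  exists s; split=> // [|m]; last exact: Emin.
  suff /(vertices_face _ pF fE) [] : vertices E s by [].
  suff : face E [set s] by move=> fEs; split=> //; apply: dim_set1.
  have sE : [set s] = E `&` [set y | l y - l s = 0].
    suff dS : affine_dim (E `&` [set y | l y - l s = 0]) 0.
      by symmetry; apply: dim0_eq => //; split=> //=; rewrite subrr.
    have [z Ez lz] : exists2 z, E z & l z - l s != 0.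
      have [e|ne] := eqVneq (l (x i)) (l s).
        by exists (x j) => //; rewrite subr_eq0 -e eq_sym.
      by exists (x i) => //; rewrite subr_eq0.
    apply: (@cut_dim _ _ E _ (fun=> s) z) => //; first exact: affine_subc.
      by split; rewrite ?subrr.
    exact: indep_const.
  apply/faceP; exists (fun y => l y - l s); split=> //.
    exact: affine_subc.
  by move=> y /Emin; rewrite subr_ge0.
have k01 : k (x ord0) != k (x ord_max) by rewrite k0 k1 eq_sym oner_eq0.
(* The minimum and the maximum of [k]. *)
have [s [vs Es smin]] : exists s, [/\ vertices F s, E s & forall i, k s <= k (x i)].
  by apply: end_of => //; exists ord0, ord_max.
have [t [vt Et tmin]] :
    exists t, [/\ vertices F t, E t & forall i, - k t <= - k (x i)].
  apply: (end_of _ (affineN ak)); exists ord0, ord_max.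
  by rewrite eqr_opp.
have st : s <> t.
  move=> e; have := smin ord0; have := tmin ord_max; rewrite k0 k1 e lerN2.
  by move=> h1 h0; have := le_trans h1 h0; rewrite ler10.
have ends w : vertices F w -> E w -> w = s \/ w = t.
  move=> vw Ew; have vEw : vertices E w by apply/(vertices_face _ pF fE).
  have [i|i ->] := simplex_vertex dE (cons_pt_in Es (fun=> Et)) (pair_indep st) _ vEw.
  - have FE := face_sub fE.
    have fun_of a b : vertices F a -> E b -> a <> b ->
        exists phi, [/\ affine phi, forall z, E z -> 0 <= phi z, phi a = 0 & phi b != 0].
      move=> va Eb ab; have [phi [aphi phi0 phia phiv]] := vertex_functional va.
      exists phi; split=> // [z /FE/phi0 //|].
      by apply/eqP => /(phiv _ (FE _ Eb)) ba; case: ab.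
    case: (unliftP ord0 i) => [j ->|->]; rewrite ?ord1 ?cons_ptS ?cons_pt0.
      have [phi [aphi phi0 ? ?]] := fun_of s t vs Et st.
      exists phi; split=> // j'.
      by case: (unliftP ord0 j') => [j'' ->|->]; rewrite ?ord1 ?eqxx ?cons_pt0.
    have [phi [aphi phi0 ? ?]] := fun_of t s vt Es (fun e => st (esym e)).
    exists phi; split=> // j'.
    by case: (unliftP ord0 j') => [j'' ->|->]; rewrite ?ord1 ?eqxx ?cons_ptS.
  - by case: (unliftP ord0 i) => [j ->|->]; rewrite ?cons_ptS ?cons_pt0; auto.
case: (ends v vv Ev) => ->; [exists t|exists s]; split=> //; auto.
by move=> w vw Ew; have [] := ends w vw Ew; auto.
Qed.

(** Otherwise both edges would be cut out of [P] by the line through [v] and [p]. *)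
Lemma other_edge_point P E E' v p phi : edges P E -> edges P E' -> E <> E' ->
  E = P `&` [set y | phi y = 0] -> E v -> E' v -> E' p ->
  affinely_independent (cons_pt p (fun _ : 'I_1 => v)) -> phi p != 0.
Proof.
move=> e e' nee' EE Ev E'v E'p ip; apply/eqP => phip; case: nee'.
apply: (face_eq e e' ip); last exact: cons_pt_in.
apply: cons_pt_in => //; rewrite EE; split=> //.
by have [/face_sub E'P _] := e'; apply: E'P.
Qed.

Lemma two_edges_indep P E1 E2 v p1 p2 : edges P E1 -> edges P E2 -> E1 <> E2 ->
  E1 v -> E2 v -> E1 p1 -> E2 p2 ->
  affinely_independent (cons_pt p1 (fun _ : 'I_1 => v)) ->
  affinely_independent (cons_pt p2 (fun _ : 'I_1 => v)) ->
  affinely_independent (cons_pt p1 (cons_pt p2 (fun _ : 'I_1 => v))).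
Proof.
move=> e1 e2 n12 E1v E2v E1p E2p i1 i2.
have [fE2 _] := e2; have [phi [aphi phi0 E2E]] := (faceP P E2).1 fE2.
apply: (cons_pt_indep aphi i2) => [i|].
  have : E2 (cons_pt p2 (fun=> v) i) by apply: cons_pt_in.
  by rewrite E2E => -[].
by apply: (other_edge_point e2 e1 _ E2E E2v E1v E1p i1) => e; case: n12.
Qed.

(** Pivot the line supporting [F] at [v] only.  The function [g] vanishes at [v]
and [p] but not at [q], so that it is not proportional to [f] and the final
line does not contain all of [F]. *)
Lemma vertex_edge F v : convex_polytope F -> affine_dim F 2 -> vertices F v ->
  exists2 E, edges F E & E v.
Proof.
move=> pF dF vv; have Fv := vertex_in vv.
have [f [af f0 fv fonly]] := vertex_functional vv.
have [p Fp ip] := dim_extend dF (ltn0Sn 1) (fun=> Fv) (indep_const v).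
have Fpv := cons_pt_in Fp (fun _ : 'I_1 => Fv).
have [q Fq iq] := dim_extend dF (ltnSn 1) Fpv ip.
have [g ag gE] := indep_interp (fun i => if i == ord0 then -1 else 0) iq.
have gq : g q = -1 by have := gE ord0; rewrite cons_pt0.
have gp : g p = 0 by have := gE (lift ord0 ord0); rewrite cons_ptS cons_pt0.
have gv : g v = 0.
  by have := gE (lift ord0 (lift ord0 ord0)); rewrite !cons_ptS.
have fp : f p != 0.
  apply/eqP => /(fonly _ Fp) e; rewrite e in ip.
  have := (indepP _).1 ip (fun i => if i == ord0 then 1 else -1).
  rewrite sum_cons_pt !big_ord_recl !big_ord0 /= !addr0 scale1r scaleN1r !subrr.
  by move=> /(_ erefl erefl ord0) /eqP; rewrite /= oner_eq0.
have [|t [s [Fs fs hs h0]]] := pivot pF af ag f0 _ (ex_intro2 _ _ p Fp fp).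
  by move=> y Fy /(fonly _ Fy) ->; rewrite gv.
exists (F `&` [set y | g y + t * f y = 0]); last first.
  by split=> //=; rewrite gv fv mulr0 addr0.
have ah := affineDZ t af ag.
split; first by apply/faceP; exists (fun y => g y + t * f y).
have sv : s <> v by move=> e; rewrite e fv ltxx in fs.
apply: (@cut_dim _ _ F _ (cons_pt s (fun=> v)) p) => //.
- rewrite gp add0r mulf_neq0 //; apply/eqP => t0.
  by have := h0 q Fq; rewrite gq t0 mul0r addr0 oppr_ge0 ler10.
- move=> i; rewrite /cons_pt; case: unlift => [_|//].
  by rewrite gv fv mulr0 addr0.
- exact: pair_indep.
Qed.

(** The second edge is given by [ridge] from the first.  A third edge [E3] is
impossible: with respect to [v] and points [p1], [p2] of the first two edges,
a point of [E3] has positive coordinates along [p1] and [p2], so it lies strictly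
inside the angle, whereas the function of [E3] is positive at [p1] and [p2]. *)
Lemma polygon_edges_at F v : convex_polytope F -> affine_dim F 2 ->
  vertices F v -> exists E1 E2, [/\ edges F E1, edges F E2, E1 v, E2 v &
    E1 <> E2 /\ forall E, edges F E -> E v -> E = E1 \/ E = E2].
Proof.
move=> pF dF vv; have [E1 e1 E1v] := vertex_edge pF dF vv.
have [fE1 _] := e1.
have v1 : face_of_dim 0 E1 [set v] by apply/(vertices_face _ pF fE1).
have [E2 [e2 n21 E2v]] := ridge pF dF e1 v1.
exists E1, E2; split=> //; first exact: E2v.
split=> [e|E3 e3 E3v]; first by case: n21.
apply: contrapT => /not_orP [n31 n32].
have {E2v}E2v := E2v v erefl.
have {n21}n12 : E1 <> E2 by move=> e; case: n21.
have [p1 E1p i1] := edge_point e1 E1v.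
have [p2 E2p i2] := edge_point e2 E2v.
have [p3 E3p i3] := edge_point e3 E3v.
have [[fE2 _] [fE3 _]] := (e2, e3).
have [[E1F E2F] E3F] := (face_sub fE1, face_sub fE2, face_sub fE3).
have [f1 [af1 f10 E1E]] := (faceP F E1).1 fE1.
have [f2 [af2 f20 E2E]] := (faceP F E2).1 fE2.
have [f3 [af3 f30 E3E]] := (faceP F E3).1 fE3.
have ind := two_edges_indep e1 e2 n12 E1v E2v E1p E2p i1 i2.
have Fx := cons_pt_in (E1F _ E1p) (cons_pt_in (E2F _ E2p) (fun _ : 'I_1 => E1F _ E1v)).
have [w w1 p3E] := dim_span dF Fx ind (E3F _ E3p).
have val f : affine f -> f v = 0 -> f p3 =
    w ord0 * f p1 + w (lift ord0 ord0) * f p2.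
  move=> af fv; rewrite p3E affine_comb // !big_ord_recl big_ord0.
  by rewrite !cons_ptS !cons_pt0 fv mulr0 !addr0.
have on E f p : E = F `&` [set y | f y = 0] -> E p -> f p = 0.
  by move=> -> [].
have pos E E' f p : edges F E -> edges F E' -> E <> E' ->
    E = F `&` [set y | f y = 0] -> E v -> E' v -> E' p ->
    affinely_independent (cons_pt p (fun _ : 'I_1 => v)) ->
    (forall y, F y -> 0 <= f y) -> 0 < f p.
  move=> e e' ne EE Ev E'v E'p ip f_ge0.
  rewrite lt_neqAle eq_sym (other_edge_point e e' ne EE Ev E'v E'p ip) f_ge0 //.
  by have [/face_sub E'F _] := e'; apply: E'F.
have w0 : 0 < w ord0.
  have := pos _ _ _ _ e2 e3 (fun e => n32 (esym e)) E2E E2v E3v E3p i3 f20.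
  rewrite (val f2 af2 (on _ _ v E2E E2v)) (on _ _ p2 E2E E2p) mulr0 addr0.
  by rewrite pmulr_lgt0 // (pos E2 E1) // => e; case: n12.
have w1' : 0 < w (lift ord0 ord0).
  have := pos _ _ _ _ e1 e3 (fun e => n31 (esym e)) E1E E1v E3v E3p i3 f10.
  rewrite (val f1 af1 (on _ _ v E1E E1v)) (on _ _ p1 E1E E1p) mulr0 add0r.
  by rewrite pmulr_lgt0 // (pos E1 E2).
have := on _ _ _ E3E E3p; rewrite (val f3 af3 (on _ _ v E3E E3v)) => /eqP.
have f3p1 := pos _ _ _ _ e3 e1 n31 E3E E3v E1v E1p i1 f30.
have f3p2 := pos _ _ _ _ e3 e2 n32 E3E E3v E2v E2p i2 f30.
by rewrite gt_eqF // addr_gt0 // mulr_gt0.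
Qed.

End Polygons.

Section PolygonGraph.
Variables (R : realType) (n : nat).
Local Notation V := 'rV[R]_n.
Implicit Types (E F G P : set V) (u v w y : V).

Definition adjacent F u v :=
  [/\ vertices F u, vertices F v, u != v & exists E, [/\ edges F E, E u & E v]].

Lemma adjacent_sym F u v : adjacent F u v -> adjacent F v u.
Proof.
by move=> [fu fv uv [E [eE Eu Ev]]]; split; rewrite 1?eq_sym //; exists E.
Qed.

Lemma adjacent_two F v : convex_polytope F -> affine_dim F 2 -> vertices F v ->
  exists u1 u2, u1 != u2 /\ forall w, adjacent F v w <-> w = u1 \/ w = u2.
Proof.
move=> pF dF vv.
have [E1 [E2 [e1 e2 E1v E2v [n12 EP]]]] := polygon_edges_at pF dF vv.
have [u1 [u1v vu1 Eu1 u1P]] := edge_vertices pF e1 vv E1v.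
have [u2 [u2v vu2 Eu2 u2P]] := edge_vertices pF e2 vv E2v.
exists u1, u2; split.
  apply/eqP => u12; rewrite -u12 in Eu2; apply: n12.
  by apply: (face_eq e1 e2 (pair_indep u1v)); apply: cons_pt_in.
move=> w; split=> [[_ vw vNw [E [eE Ev Ew]]]|].
  case: (EP E eE Ev) Ew => -> Ew.
    by case: (u1P w vw Ew) => [wv|->]; [rewrite wv eqxx in vNw|left].
  by case: (u2P w vw Ew) => [wv|->]; [rewrite wv eqxx in vNw|right].
by case=> ->; split=> //; rewrite 1?eq_sym; try exact/eqP; [exists E1|exists E2].
Qed.

Lemma edge_three_vertices F E u v w : convex_polytope F -> edges F E ->
  vertices F u -> vertices F v -> vertices F w -> E u -> E v -> E w ->
  u != v -> v != w -> w != u -> False.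
Proof.
move=> pF eE vu vv vw Eu Ev Ew uv /eqP vNw /eqP wNu.
have [z [_ _ _ zP]] := edge_vertices pF eE vu Eu.
case: (zP v vv Ev) => [e|ev]; first by rewrite e eqxx in uv.
by case: (zP w vw Ew) => // ew; apply: vNw; rewrite ev ew.
Qed.

(** The three edges bound the triangle, so [simplex_vertex] applies. *)
Lemma adjacent_triangle F u v w : convex_polytope F -> affine_dim F 2 ->
  adjacent F u v -> adjacent F v w -> adjacent F w u ->
  forall y, vertices F y -> [\/ y = u, y = v | y = w].
Proof.
move=> pF dF [vu vv uv [E1 [e1 E1u E1v]]] [_ vw vNw [E2 [e2 E2v E2w]]].
move=> [_ _ wu [E3 [e3 E3w E3u]]] y vy.
have opposite E a b d : edges F E -> E a -> E b -> vertices F a ->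
    vertices F b -> vertices F d -> a != b -> b != d -> d != a ->
    exists phi, [/\ affine phi, forall z, F z -> 0 <= phi z,
      phi a = 0, phi b = 0 & phi d != 0].
  move=> eE Ea Eb va vb vd ab bd da.
  have [fE _] := eE; have [phi [aphi phi0 EE]] := (faceP F E).1 fE.
  have on z : E z -> phi z = 0 by rewrite EE => -[].
  exists phi; split=> //; [exact: on|exact: on|].
  apply/eqP => phid; apply: (edge_three_vertices pF eE va vb vd) => //.
  by rewrite EE; split=> //; apply: vertex_in.
have [f1 [af1 f10 f1u f1v f1w]] := opposite _ _ _ _ e1 E1u E1v vu vv vw uv vNw wu.
have [f2 [af2 f20 f2v f2w f2u]] := opposite _ _ _ _ e2 E2v E2w vv vw vu vNw wu uv.
have [f3 [af3 f30 f3w f3u f3v]] := opposite _ _ _ _ e3 E3w E3u vw vu vv wu uv vNw.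
have ivw := pair_indep (elimN eqP vNw).
have ind : affinely_independent (cons_pt u (cons_pt v (fun _ : 'I_1 => w))).
  apply: (cons_pt_indep af2 ivw) => // i; rewrite /cons_pt.
  by case: unlift.
have Fx := cons_pt_in (vertex_in vu)
  (cons_pt_in (vertex_in vv) (fun _ : 'I_1 => vertex_in vw)).
have ord3 (i : 'I_3) : [\/ i = ord0, i = lift ord0 ord0 | i = lift ord0 (lift ord0 ord0)].
  case: (unliftP ord0 i) => [j ->|->]; last by constructor 1.
  case: (unliftP ord0 j) => [j' ->|->]; last by constructor 2.
  by rewrite ord1; constructor 3.
have [i|i ->] := simplex_vertex dF Fx ind _ vy.
  have nth_x := (cons_pt0, cons_ptS).
  case: (ord3 i) => ->; [exists f2|exists f3|exists f1]; rewrite !nth_x;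
    split=> // j; case: (ord3 j) => ->; rewrite ?eqxx ?nth_x //.
by case: (ord3 i) => ->; rewrite !(cons_pt0, cons_ptS);
  [constructor 1|constructor 2|constructor 3].
Qed.

End PolygonGraph.

(** * Links of the facets of a simple polyhedron *)

Section Polyhedra.
Variable R : realType.
Local Notation V := 'rV[R]_3.
Implicit Types (E F G K P : set V) (u v w y : V).

Lemma facet_eq P v F G E1 E2 : face_of_dim 2 P F -> face_of_dim 2 P G ->
  edges P E1 -> edges P E2 -> E1 <> E2 -> E1 v -> E2 v ->
  E1 `<=` F -> E2 `<=` F -> E1 `<=` G -> E2 `<=` G -> F = G.
Proof.
move=> fF fG e1 e2 n12 E1v E2v E1F E2F E1G E2G.
have [p1 E1p i1] := edge_point e1 E1v.
have [p2 E2p i2] := edge_point e2 E2v.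
have ind := two_edges_indep e1 e2 n12 E1v E2v E1p E2p i1 i2.
apply: (face_eq fF fG ind).
  by do 2?apply: cons_pt_in; auto.
by do 2?apply: cons_pt_in; auto.
Qed.

(** Each facet at [v] contains two of the three edges, hence omits at most one.
Two facets omitting the same edge share the other two. *)
Lemma facets_at_vertex P v (ks : seq (set V)) : convex_polytope P ->
  vertices P v -> degree_eq P v 3 -> uniq ks ->
  (forall K, K \in ks -> [/\ facets P K, convex_polytope K & K v]) ->
  (size ks <= 3)%N.
Proof.
move=> pP vv /card_seq [es [ues ses esP]] uks ksP.
(* Membership stays inside the statement so that [choice] gives a total function. *)
have omit K : exists E, K \in ks ->
    E \in es /\ forall E', E' \in es -> E' != E -> E' `<=` K.
  have [Kks|nK] := boolP (K \in ks); last by exists set0.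
  have [fK pK Kv] := ksP K Kks; have [ffK dK] := fK.
  have vK : vertices K v by apply/(vertices_face _ pP ffK).
  have [E1 [E2 [e1 e2 E1v E2v [n12 _]]]] := polygon_edges_at pK dK vK.
  have [P1 K1] := (face_of_dim_face _ _ pP ffK).1 e1.
  have [P2 K2] := (face_of_dim_face _ _ pP ffK).1 e2.
  have E1es : E1 \in es by apply/esP.
  have E2es : E2 \in es by apply/esP.
  have [E Ees nE] : exists2 E, E \in es & E \notin [:: E1; E2].
    apply/hasP; have : (size [:: E1; E2] < size es)%N by rewrite ses.
    apply: contraLR => /hasPn sub; rewrite -leqNgt.
    by apply: uniq_leq_size => // x /sub; rewrite negbK.
  exists E => _; split=> // E' E'es nE'E.
  have u12E : uniq [:: E; E1; E2].
    by rewrite cons_uniq nE /= inE andbT; apply/eqP.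
  have sub : {subset [:: E; E1; E2] <= es}.
    by apply/allP; rewrite /= E1es E2es Ees.
  have [_ esE] := uniq_min_size u12E sub (eq_leq ses).
  by move: E'es; rewrite -esE inE (negPf nE'E) /= !inE => /orP[] /eqP ->.
have [o oP] := choice omit.
suff : (size (map o ks) <= size es)%N by rewrite size_map ses.
apply: uniq_leq_size; last first.
  by move=> E /mapP [K Kks ->]; case: (oP K Kks).
rewrite map_inj_in_uniq // => K L Kks Lks oKL.
have [oes oK] := oP K Kks; have [_] := oP L Lks; rewrite -oKL => oL.
have : (1 < size (rem (o K) es))%N by rewrite size_rem // ses.
have := rem_uniq (o K) ues.
have remP E : E \in rem (o K) es -> E != o K /\ E \in es.
  by rewrite mem_rem_uniq // inE => /andP.
case: (rem _ _) remP => [//|E1 [//|E2 s]] remP /= /andP[n12 _] _.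
have [n1 e1] : E1 != o K /\ E1 \in es by apply: remP; rewrite !inE eqxx.
have [n2 e2] : E2 != o K /\ E2 \in es by apply: remP; rewrite !inE eqxx orbT.
have [fK _ _] := ksP K Kks; have [fL _ _] := ksP L Lks.
have [[P1 E1v] [P2 E2v]] := ((esP E1).2 e1, (esP E2).2 e2).
apply: (facet_eq fK fL P1 P2 _ E1v E2v); auto.
by apply/eqP; move: n12; rewrite inE negb_or => /andP[].
Qed.

(** Two facets meet in a face of dimension at most one. *)
Lemma facets_share_edge P F G u v w : convex_polytope F -> facets P F ->
  facets P G -> F <> G -> vertices F u -> vertices F v -> vertices F w ->
  G u -> G v -> G w -> u != v -> v != w -> w != u -> False.
Proof.
move=> pF fF fG nFG vu vv vw Gu Gv Gw uv vNw wu.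
have [/faceP [phi [aphi phi0 GE]] dG] := fG.
have FP : F `<=` P by have [/face_sub] := fF.
have Gon y : G y -> phi y = 0 by rewrite GE => -[].
have [s Fs phis] : exists2 s, F s & phi s != 0.
  apply: contrapT => nex; apply: nFG; have [_ [[x [Fx ix]] _]] := fF.
  apply: (face_eq fF fG ix Fx) => i; rewrite GE; split; first exact: FP.
  by apply: contrapT => /eqP phix; apply: nex; exists (x i).
have [Fu [Fv Fw]] := (vertex_in vu, (vertex_in vv, vertex_in vw)).
have [_ dF] := fF.
have eE : edges F (F `&` [set y | phi y = 0]).
  split; first by apply/faceP; exists phi; split=> // y /FP/phi0.
  apply: (cut_dim dF aphi Fs phis (x := cons_pt u (fun _ : 'I_1 => v))).
    by move=> i; rewrite /cons_pt; case: unlift => [_|]; split=> //; apply: Gon.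
  by apply: pair_indep; apply/eqP.
by apply: (edge_three_vertices pF eE vu vv vw) => //; split=> //; apply: Gon.
Qed.

Definition meet_at_vertex P F G K :=
  [/\ facets P F, facets P G, facets P K, [/\ F <> G, F <> K & G <> K] &
    exists v, [/\ vertices P v, F v, G v & K v]].

Lemma meet_at_vertex_rev P F G K :
  meet_at_vertex P F G K -> meet_at_vertex P F K G.
Proof.
move=> [fF fG fK [FG FK GK] [v [vv Fv Gv Kv]]].
by split=> //; [split=> // e; case: GK|exists v].
Qed.

Lemma meet_at_vertex_swap P F G K :
  meet_at_vertex P F G K -> meet_at_vertex P G F K.
Proof.
move=> [fF fG fK [FG FK GK] [v [vv Fv Gv Kv]]].
by split=> //; [split=> // e; case: FG|exists v].
Qed.

Lemma polygon_cycle m F : (4 < m <= 6)%N -> convex_polygon m F ->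
  exists c, [/\ uniq c, size c = m, forall v, vertices F v <-> v \in c &
    forall v, v \in c -> adjacent F v (next c v)].
Proof.
move=> m46 [pF dF /card_seq [vs [uvs svs vsP]]].
have [||||||c [uc cE cP]] := @two_regular_cycle _ (adjacent F) vs.
- by move=> x y [/vsP ? /vsP ?].
- exact: adjacent_sym.
- by move=> x /vsP vx; apply: adjacent_two.
- move=> x y z xy yz zx.
  have tri := adjacent_triangle pF dF xy yz zx.
  have : (size vs <= size [:: x; y; z])%N.
    by apply: uniq_leq_size => // w /vsP/tri [] ->; rewrite !inE eqxx ?orbT.
  by rewrite svs /=; lia.
- by [].
- by rewrite svs.
exists c; split=> //; last by move=> v; rewrite vsP cE.
by rewrite -svs; apply: perm_size; apply: uniq_perm.
Qed.

(** Each side of [F] has another facet on its far side, and listing those along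
the vertex cycle of [F] gives the link.  They are distinct because two
facets share at most two vertices, and the two of them containing a vertex [v]
are the only facets there besides [F]. *)
Lemma facet_link P F m : convex_polyhedron P ->
  (forall v, vertices P v -> degree_eq P v 3) ->
  (forall G, facets P G -> convex_polytope G) ->
  facets P F -> (4 < m <= 6)%N -> convex_polygon m F ->
  exists2 c, size c = m & link_is (meet_at_vertex P) F c.
Proof.
move=> [pP dP] deg3 polyP fF m46 polyF; have [ffF dF] := fF.
have pF := polyP F fF.
have [c [uc sc cP cadj]] := polygon_cycle m46 polyF.
have c2 : (2 < size c)%N by rewrite sc; lia.
(* Membership stays inside the statement so that [choice] gives a total function. *)
have across x : exists G, x \in c ->
    [/\ facets P G, G <> F, G x & G (next c x)].
  have [xc|nx] := boolP (x \in c); last by exists set0.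
  have [_ _ _ [E [eE Ex Ey]]] := cadj x xc.
  have [G [fG GF EG]] := ridge pP dP fF eE.
  by exists G => _; split=> //; apply: EG.
have [g gP] := choice across.
have g_inj x y : x \in c -> y \in c -> g x = g y -> x = y.
  move=> xc yc gxy; apply/eqP; apply: contraT => nxy.
  have [fG GF Gx Gx'] := gP x xc; have [_ _ Gy Gy'] := gP y yc.
  rewrite -gxy in Gy Gy'.
  have vx := (cP x).2 xc; have vy := (cP y).2 yc.
  have [_ vx' nxx' _] := cadj x xc; have [_ vy' nyy' _] := cadj y yc.
  have FG : F <> g x by move=> e; apply: GF.
  have [e|ne] := eqVneq (next c x) y.
    apply: False_ind; apply: (facets_share_edge pF fF fG FG vx vy vy') => //.
    by rewrite -e next2_neq.
  by apply: False_ind; apply: (facets_share_edge pF fF fG FG vx vx' vy) => //; rewrite eq_sym.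
have ugc : uniq (map g c) by rewrite map_inj_in_uniq.
have vertexP v : v \in c -> vertices P v /\ F v.
  by move=> /cP /(vertices_face _ pP ffF).
have meet x : x \in c -> meet_at_vertex P F (g x) (g (next c x)).
  move=> xc; have yc : next c x \in c by rewrite mem_next.
  have [fG GF _ Gy] := gP x xc; have [fG' G'F G'y _] := gP _ yc.
  split=> //; last by exists (next c x); have [] := vertexP _ yc.
  split=> [e|e|/(g_inj _ _ xc yc) e]; [exact: GF|exact: G'F|].
  by have [_ _] := cadj x xc; rewrite -e eqxx.
exists (map g c); first by rewrite size_map.
split=> // A B; split; last first.
  case=> -[/mapP [x xc ->] ->]; rewrite next_map_uniq //; first exact: meet.
  exact/meet_at_vertex_rev/meet.
move=> [_ fA fB [FA FB AB] [v [vv Fv Av Bv]]].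
have vc : v \in c by apply/cP/(vertices_face _ pP ffF).
have pc : prev c v \in c by rewrite mem_prev.
have npv : next c (prev c v) = v by rewrite next_prev.
have [[fG GF Gv _] [fG' G'F _ G'v]] := (gP v vc, gP _ pc).
rewrite npv in G'v.
have pv : g (prev c v) <> g v.
  by have [_ _ _ [_ _]] := meet _ pc; rewrite npv.
have only K : facets P K -> K v -> F <> K -> K = g (prev c v) \/ K = g v.
  move=> fK Kv FK; apply: contrapT => /not_orP [n1 n2].
  suff : (size [:: F; g (prev c v); g v; K] <= 3)%N by [].
  apply: (facets_at_vertex pP vv (deg3 v vv)).
    by apply: uniq4; auto.
  by move=> L; rewrite !inE => /or4P[] /eqP ->; split; auto.
have step : next (map g c) (g (prev c v)) = g v by rewrite next_map_uniq // npv.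
have gpc : g (prev c v) \in map g c by exact: map_f.
case: (only A fA Av FA) (only B fB Bv FB) => eA [] eB; try by case: AB; rewrite eA eB.
- by left; rewrite eA eB step.
- by right; rewrite eA eB step.
Qed.

End Polyhedra.

Theorem corollary2 (R : realType) :
  ~ exists P : set 'rV[R]_3, fullerene P /\ (hexagonal_faces P #= `I_1).
Proof.
move=> [P [[polyP deg3 facetP] /card_seq [hs [_ shs hsP]]]].
case: hs shs hsP => [//|H [|//]] _ hsP.
have [fH polyH] : hexagonal_faces P H by apply/hsP; rewrite inE.
have polytopeP G : facets P G -> convex_polytope G.
  by move=> /facetP [] [_ []].
have [h sh linkH] := @facet_link _ P H 6 polyP deg3 polytopeP fH isT polyH.
apply: (@no_single_hexagon _ (meet_at_vertex P) H _ _ _ h linkH sh).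
- by move=> A x y; apply: meet_at_vertex_swap.
- by move=> A x y; apply: meet_at_vertex_rev.
- by move=> A x y [_ _ _ []].
move=> A x y [fA _ _ _ _] nAH.
case: (facetP A fA) => [[_ polyA]|hexA].
  exact: (@facet_link _ P A 5 polyP deg3 polytopeP fA isT polyA).
by case: nAH; move/hsP: hexA; rewrite inE => /eqP.
Qed.
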